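(* Let $T$ be a tetrahedron in Euclidean $3$-space with vertices $P_1, P_2, P_3, P_4$ and edge lengths $$a = |P_1P_2|,\quad b = |P_1P_3|,\quad c = |P_3P_4|,\quad d = |P_2P_3|,\quad e = |P_1P_4|,\quad f = |P_2P_4|,$$ so that the edges $P_2P_3$ and $P_1P_4$, of lengths $d$ and $e$, are non-incident. Then the area of the medial parallelogram of $T$ determined by the pair of edges $P_2P_3$ and $P_1P_4$ is $$\frac{1}{8}\sqrt{4d^2e^2 - (b^2 + f^2 - a^2 - c^2)^2}.$$
   Context: Given a pair of non-incident (i.e. sharing no vertex) edges of a tetrahedron, the medial parallelogram determined by the pair is the parallelogram whose vertices are the midpoints of the remaining four edges. (These four midpoints lie in a plane parallel to both chosen edges and are the vertices of a parallelogram in it.) For the pair $P_2P_3$, $P_1P_4$, its vertices are, in cyclic order, the midpoints of $P_1P_2$, $P_1P_3$, $P_3P_4$, $P_2P_4$, the edges of lengths $a$, $b$, $c$, $f$ respectively. *)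

(* Defs.v *)
From HB Require Import structures.
From mathcomp Require Export all_boot all_order all_algebra.
From mathcomp Require Export all_classical all_reals all_analysis.

Set Implicit Arguments.
Unset Strict Implicit.
Unset Printing Implicit Defensive.

Import Order.TTheory GRing.Theory Num.Theory.

Local Open Scope classical_set_scope.
Local Open Scope ring_scope.

Section Euclidean3.
Context {R : realType}.
Implicit Types (P Q o u v : 'rV[R]_3) (S : set 'rV[R]_3).

Definition dotp u v : R := \sum_(i < 3) u 0 i * v 0 i.

(* The library norm on 'rV[R]_3 is the sup norm, hence this definition. *)
Definition edist P Q : R := Num.sqrt (dotp (P - Q) (P - Q)).

Definition midpoint P Q : 'rV[R]_3 := 2^-1 *: (P + Q).

(* Four points are the vertices of a (nondegenerate) tetrahedron when they
   are affinely independent. *)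
Definition tetrahedron P1 P2 P3 P4 : bool :=
  free [:: P2 - P1; P3 - P1; P4 - P1].

Definition convex_hull S : set 'rV[R]_3 :=
  smallest (@convex_set R 'rV[R]_3) S.

(* The solid medial parallelogram of the tetrahedron Q1 Q2 Q3 Q4 determined by
   the non-incident edges Q1 Q2 and Q3 Q4.  Its vertices, the midpoints of the
   other four edges, are listed in cyclic order. *)
Definition medial_parallelogram Q1 Q2 Q3 Q4 : set 'rV[R]_3 :=
  convex_hull [set midpoint Q1 Q3; midpoint Q2 Q3;
                   midpoint Q2 Q4; midpoint Q1 Q4].

Definition orthonormal_pair u v : Prop :=
  [/\ dotp u u = 1, dotp v v = 1 & dotp u v = 0].

(* For orthonormal u and v, an isometric parametrization of the plane through
   o directed by u and v. *)
Definition plane_point o u v (z : R * R) : 'rV[R]_3 := o + z.1 *: u + z.2 *: v.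

Definition lebesgue2 : set (R * R) -> \bar R :=
  (@lebesgue_measure R \x @lebesgue_measure R)%E.

(* The region S lies in a plane and has area al there.  The area is the
   two-dimensional Lebesgue measure of S read in Cartesian coordinates of a
   plane containing S, for every choice of these coordinates; the first clause
   rules out vacuity. *)
Definition has_planar_area S (al : R) : Prop :=
  (exists o u v, orthonormal_pair u v /\ S `<=` range (plane_point o u v)) /\
  (forall o u v, orthonormal_pair u v -> S `<=` range (plane_point o u v) ->
     lebesgue2 (plane_point o u v @^-1` S) = al%:E).

End Euclidean3.

(* Main.v *)
Require Import Defs.
From mathcomp Require Import measurable_realfun ring lra.
Import Order.TTheory GRing.Theory Num.Theory.
Import numFieldNormedType.Exports.
Local Open Scope classical_set_scope.
Local Open Scope ring_scope.

(** The medial parallelogram is spanned, from the midpoint of P1P2, by the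
    halves p and q of the vectors P2P3 and P1P4.  Its squared area is therefore
    the Gram determinant |p|^2 |q|^2 - (p.q)^2.  Expanding squared distances,
    b^2 + f^2 - a^2 - c^2 = 2 (P3 - P2).(P4 - P1) = 8 p.q, while d = 2 |p| and
    e = 2 |q|, so 64 times the Gram determinant is the radicand of the theorem.

    What needs work is that the area, a Lebesgue measure, is the square root of
    the Gram determinant ([planar_area_parallelogram]).  The convex hull of the
    four vertices is the set of all A + s p + t q with s and t in [0, 1]
    ([convex_hull_parallelogram]).  In any Cartesian coordinates of its plane
    this is a parallelogram of R^2, whose measure is the absolute value of the
    determinant of the coordinates of p and q ([lebesgue2_parallelogram2]); the
    square of that determinant is the Gram determinant, since the coordinate
    vectors are orthonormal ([gram_orthonormal]).

    For the planar measure, a vertical shear makes one pair of sides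
    horizontal.  It preserves the measure, because it only translates each
    vertical section ([lebesgue2_shear]).  Afterwards the horizontal sections
    are segments of constant length over a segment of heights, and Fubini's
    theorem gives base times height ([parallelogram2_horizontal]). *)

Set Implicit Arguments.
Unset Strict Implicit.
Unset Printing Implicit Defensive.

(** * Measure of a parallelogram of the coordinate plane *)

Section Planar.
Context {R : realType}.
Notation mu := (@lebesgue_measure R).

(** The translate of the Lebesgue measure is a measure with the same values on
    half-open intervals, and these values determine the measure. *)
Lemma lebesgue_measure_translate (k : R) (A : set (measurableTypeR R)) :
  measurable A -> mu ((fun y => y + k) @^-1` A) = mu A.
Proof.
move=> mA.
have mf : measurable_fun setT
    ((fun y => y + k) : measurableTypeR R -> measurableTypeR R).
  by apply: measurable_funD => //; exact: measurable_cst.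
pose nu :=
  measure_function_pushforward__canonical__measure_function_Measure mu mf.
rewrite [RHS](lebesgue_measure_unique (mu := nu))// => _ [[x y] _ <-].
rewrite /= /pushforward.
rewrite [X in _ = mu X](_ : _ = `]x - k, y - k]%classic); last first.
  by apply/seteqP; split => z; rewrite /= !in_itv/= ltrBlDr lerBrDr.
rewrite !lebesgue_measure_itv/= !lte_fin ltrD2r; case: ifP => // _.
by rewrite -!EFinD; congr EFin; ring.
Qed.

(** The parameter r is signed, so that the ends need not be sorted when a
    section is later recognized as a segment. *)
Definition segment (c r : R) : set R := [set c + t * r | t in `[0, 1]].

Lemma segmentE (c r : R) :
  segment c r = `[Order.min c (c + r), Order.max c (c + r)]%classic.
Proof.
apply/seteqP; split => [_ [t] /= + <-|x] /=; rewrite !in_itv/= => /andP[].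
- move=> t0 t1; have [r0|r0] := leP 0 r.
    by rewrite minEle maxEle lerDl r0; apply/andP; split; nra.
  by rewrite minEle maxEle lerDl (lt_geF r0)/=; apply/andP; split; nra.
- have [->|r0] := eqVneq r 0.
    rewrite addr0 minxx maxxx => cx xc.
    exists 0 => /=; first by rewrite in_itv/= lexx ler01.
    by rewrite mulr0 addr0; apply/eqP; rewrite eq_le cx xc.
  move=> x1 x2; exists ((x - c) / r); last by rewrite /= mulfVK// addrC subrK.
  rewrite /= in_itv/=.
  have [rp|rn] := ltP 0 r.
    move: x1 x2; rewrite minEle maxEle lerDl (ltW rp) => x1 x2.
    by rewrite divr_ge0 ?subr_ge0 ?(ltW rp)//= ler_pdivrMr// mul1r; lra.
  have {rn r0}rn : r < 0 by rewrite lt_neqAle r0.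
  move: x1 x2; rewrite minEle maxEle lerDl (lt_geF rn) /= => x1 x2.
  rewrite ler_ndivlMr// ler_ndivrMr// mul0r mul1r; apply/andP; split; lra.
Qed.

Lemma measurable_segment c r : measurable (segment c r : set (measurableTypeR R)).
Proof. by rewrite segmentE; exact: measurable_itv. Qed.

Lemma lebesgue_measure_segment c r : mu (segment c r) = `|r|%:E.
Proof.
rewrite segmentE lebesgue_measure_itv/= lte_fin.
have [r0|r0] := leP 0 r.
  rewrite minEle maxEle lerDl r0 ltrDl ger0_norm//.
  case: ltgtP r0 => // [r0 _|<- _]; last by [].
  by rewrite -EFinD; congr EFin; ring.
rewrite minEle maxEle lerDl (lt_geF r0)/= ltr0_norm// gtrDl r0.
by rewrite -EFinD; congr EFin; ring.
Qed.

(** The section of the sheared set at x is the section of A at x translated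
    by - k x, so both have the same integral over x. *)
Lemma lebesgue2_shear (k : R) (A : set (R * R)) :
  measurable (A : set (measurableTypeR R * measurableTypeR R)) ->
  lebesgue2 [set z | A (z.1, z.2 + k * z.1)] = lebesgue2 A.
Proof.
move=> mA; apply: eq_integral => x _ /=.
rewrite -(@lebesgue_measure_translate (k * x) (xsection A x)); last first.
  exact: measurable_xsection.
by congr (mu _); rewrite !xsectionE.
Qed.

Definition parallelogram2 (a1 a2 p1 p2 q1 q2 : R) : set (R * R) :=
  [set z | exists s t, [/\ s \in `[0, 1], t \in `[0, 1],
     z.1 = a1 + s * p1 + t * q1 & z.2 = a2 + s * p2 + t * q2]].

(** The section at height c + t r is the segment from a1 + t q1 with direction
    p1, of length |p1| whatever t is, and these heights form a segment of length
    |r|.  Integrating sections over heights instead of abscissas is Fubini's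
    theorem for a set, which is where measurability enters. *)
Lemma parallelogram2_horizontal (a1 c p1 q1 r : R) : p1 != 0 -> r != 0 ->
  measurable (parallelogram2 a1 c p1 0 q1 r :
    set (measurableTypeR R * measurableTypeR R)) /\
  lebesgue2 (parallelogram2 a1 c p1 0 q1 r) = `|p1 * r|%:E.
Proof.
move=> p0 r0.
have mS : measurable (parallelogram2 a1 c p1 0 q1 r :
    set (measurableTypeR R * measurableTypeR R)).
  (* g and h recover the parameters t and s of a point, so the set is the
     preimage of the unit square under a measurable map. *)
  pose g (z : R * R) : measurableTypeR R := (z.2 - c) / r.
  pose h (z : R * R) : measurableTypeR R := (z.1 - a1 - g z * q1) / p1.
  have mg : measurable_fun setT (g : measurableTypeR R * measurableTypeR R -> _).
    by apply: measurable_funM => //; apply: measurable_funB.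
  have mh : measurable_fun setT (h : measurableTypeR R * measurableTypeR R -> _).
    apply: measurable_funM => //; apply: measurable_funB => //.
      exact: measurable_funB.
    exact: measurable_funM.
  rewrite [X in measurable X](_ : _ = (h @^-1` `[0, 1]) `&` (g @^-1` `[0, 1])).
    by apply: measurableI; rewrite -[X in measurable X]setTI;
      [apply: mh|apply: mg].
  apply/seteqP; split => -[x y] /=; rewrite /parallelogram2/=.
    move=> [s [t [s01 t01 -> ->]]].
    have gE : g (a1 + s * p1 + t * q1, c + s * 0 + t * r) = t.
      by rewrite /g/=; field.
    have hE : h (a1 + s * p1 + t * q1, c + s * 0 + t * r) = s.
      by rewrite /h gE/=; field.
    by rewrite hE gE.
  move=> [hz gz]; exists (h (x, y)), (g (x, y)); split => //.
    by rewrite /h/=; field.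
  by rewrite /g/=; field.
split => //.
transitivity ((mu \x^ mu)%E (parallelogram2 a1 c p1 0 q1 r)).
  apply: product_measure_unique => // B C mB mC; exact: product_measure2E.
rewrite /product_measure2.
transitivity (\int[mu]_y (`|p1|%:E * (\1_(segment c r) y)%:E))%E.
  apply: eq_integral => y _ /=; rewrite ysectionE/= indicE.
  have [|yS] := boolP (y \in segment c r).
    rewrite inE/= => -[t t01 <-]; rewrite mule1.
    rewrite -(@lebesgue_measure_segment (a1 + t * q1) p1); congr (mu _).
    apply/seteqP; split => [x [s [t' [s01 t'01 /= -> e]]]|_ [s s01 <-]] /=.
      have <- : t' = t by apply: (mulIf r0); lra.
      by exists s => //; ring.
    exists s, t; split => //=; ring.
  rewrite mule0 [X in mu X](_ : _ = set0) ?measure0//.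
  apply/seteqP; split => // x [s [t [s01 t01 /= _ e]]].
  move: yS; rewrite notin_setE; apply; exists t => //.
  by rewrite e; ring.
have mE : measurable_fun setT
    (fun y : measurableTypeR R => (\1_(segment c r) y)%:E : \bar R).
  by apply/measurable_EFinP; apply: measurable_indic; exact: measurable_segment.
rewrite ge0_integralZl// (@integral_indic _ (measurableTypeR R)) ?setIT; last 2 first.
- by [].
- exact: measurable_segment.
by rewrite normrM EFinM; congr (_ * _)%E; exact: lebesgue_measure_segment.
Qed.

(** The shear of slope p2 / p1 maps the horizontal side p1 onto (p1, p2), and
    turns q2 into q2 - (p2 / p1) q1 when undone on q. *)
Lemma lebesgue2_parallelogram2 (a1 a2 p1 p2 q1 q2 : R) :
  p1 * q2 - p2 * q1 != 0 ->
  lebesgue2 (parallelogram2 a1 a2 p1 p2 q1 q2) = `|p1 * q2 - p2 * q1|%:E.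
Proof.
(* A vertical p cannot be sheared horizontal; then q is not vertical, and
   exchanging p and q leaves the set unchanged. *)
wlog p0 : p1 p2 q1 q2 / p1 != 0.
  move=> H D0; have [p0|p0] := eqVneq p1 0; last exact: H.
  have q0 : q1 != 0.
    by apply: contra_neq D0 => ->; rewrite p0; ring.
  rewrite [X in lebesgue2 X](_ : _ = parallelogram2 a1 a2 q1 q2 p1 p2).
    have DE : q1 * p2 - q2 * p1 = - (p1 * q2 - p2 * q1) by ring.
    by rewrite H ?DE ?oppr_eq0// normrN.
  by apply/seteqP; split => -[x y] [s [t [s01 t01 /= -> ->]]];
    exists t, s; split => //=; ring.
move=> D0; pose k := p2 / p1.
have DE : p1 * q2 - p2 * q1 = p1 * (q2 - k * q1) by rewrite /k; field.
have r0 : q2 - k * q1 != 0.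
  by apply: contra_neq D0; rewrite DE => ->; rewrite mulr0.
have [mS S] := @parallelogram2_horizontal a1 (a2 - k * a1) p1 q1 _ p0 r0.
rewrite DE -S -(lebesgue2_shear (- k) mS); congr lebesgue2.
apply/seteqP; split => -[x y] [s [t [s01 t01 /= e1 e2]]];
  exists s, t; split => //=; have kp : k * p1 = p2 by rewrite /k mulfVK.
  by rewrite e1 e2 -kp; ring.
by rewrite -[LHS](addrK (- k * x)) e2 e1 -kp; ring.
Qed.
End Planar.

(** * The solid parallelogram and its Gram determinant *)

Section Space.
Context {R : realType}.
Implicit Types (A p q u v o : 'rV[R]_3).

Lemma dotpC u v : dotp u v = dotp v u.
Proof. by apply: eq_bigr => i _; rewrite mulrC. Qed.

Lemma dotpDl u v w : dotp (u + v) w = dotp u w + dotp v w.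
Proof. by rewrite -big_split; apply: eq_bigr => i _; rewrite mxE mulrDl. Qed.

Lemma dotpZl (k : R) u v : dotp (k *: u) v = k * dotp u v.
Proof. by rewrite /dotp mulr_sumr; apply: eq_bigr => i _; rewrite mxE mulrA. Qed.

Lemma dotpDr u v w : dotp w (u + v) = dotp w u + dotp w v.
Proof. by rewrite dotpC dotpDl !(dotpC _ w). Qed.

Lemma dotpZr (k : R) u v : dotp v (k *: u) = k * dotp v u.
Proof. by rewrite dotpC dotpZl dotpC. Qed.

Lemma dotpNl u v : dotp (- u) v = - dotp u v.
Proof. by rewrite -scaleN1r dotpZl mulN1r. Qed.

Lemma dotpNr u v : dotp v (- u) = - dotp v u.
Proof. by rewrite dotpC dotpNl dotpC. Qed.

Definition dotpE := (dotpDl, dotpDr, dotpZl, dotpZr, dotpNl, dotpNr).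

Lemma dotp_ge0 u : 0 <= dotp u u.
Proof. by apply: sumr_ge0 => i _; rewrite -expr2 sqr_ge0. Qed.

Lemma dotp_gt0 u : u != 0 -> 0 < dotp u u.
Proof.
move=> u0; rewrite lt_neqAle dotp_ge0 andbT eq_sym; apply: contra_neq u0.
move=> /psumr_eq0P u0; apply/rowP => i; rewrite mxE.
by apply/eqP; rewrite -sqrf_eq0 expr2 u0// => j _; rewrite -expr2 sqr_ge0.
Qed.

Lemma sqr_edist p q : edist p q ^+ 2 = dotp (p - q) (p - q).
Proof. by rewrite sqr_sqrtr// dotp_ge0. Qed.

Definition parallelogram A p q : set 'rV[R]_3 :=
  [set x | exists s t,
     [/\ s \in `[0, 1], t \in `[0, 1] & x = A + s *: p + t *: q]].

Lemma convex_parallelogram A p q : convex_set (parallelogram A p q).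
Proof.
move=> x y l; rewrite !inE => -[s [t [s01 t01 ->]]] [s' [t' [s'01 t'01 ->]]].
move: s01 t01 s'01 t'01.
rewrite !in_itv/= => /andP[? ?] /andP[? ?] /andP[? ?] /andP[? ?].
have l0 : 0 <= l%:num by []. have l1 : l%:num <= 1 by [].
exists (l%:num * s + (1 - l%:num) * s'), (l%:num * t + (1 - l%:num) * t').
rewrite !in_itv/=; split; [by apply/andP; split; nra | by apply/andP; split; nra|].
rewrite /conv/= /unstable.onem; apply/rowP => i; rewrite !mxE; ring.
Qed.

(** A point with parameters s and t is a convex combination, with weight t, of
    the points with parameter s on the two sides parallel to p. *)
Lemma convex_hull_parallelogram A p q :
  convex_hull [set A; A + p; A + p + q; A + q] = parallelogram A p q.
Proof.
apply/seteqP; split.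
  apply: smallest_sub; first exact: convex_parallelogram.
  have i0 : (0 : R) \in `[0, 1] by rewrite in_itv/= lexx ler01.
  have i1 : (1 : R) \in `[0, 1] by rewrite in_itv/= lexx ler01.
  move=> x [[[->|->]|->]|->]; [exists 0, 0|exists 1, 0|exists 1, 1|exists 0, 1];
    by split => //; rewrite ?scale0r ?scale1r ?addr0.
move=> x [s [t [s01 t01 ->]]] C [cC sC].
have mix y z (l : R) : l \in `[0, 1] -> C y -> C z -> C ((1 - l) *: y + l *: z).
  rewrite in_itv/= => l01 Cy Cz.
  have h : Itv.spec (@Itv.num_sem R) (Itv.Real `[0%Z, 1%Z]) l.
    by rewrite /= /Itv.num_sem/= in_itv/= ger0_real//; case/andP: l01.
  have := cC z y (Itv.mk h); rewrite !inE => /(_ Cz Cy).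
  by rewrite /conv/= /unstable.onem addrC.
have -> : A + s *: p + t *: q = (1 - t) *: ((1 - s) *: A + s *: (A + p)) +
                                 t *: ((1 - s) *: (A + q) + s *: (A + p + q)).
  by apply/rowP => i; rewrite !mxE; ring.
apply: (mix) => //; apply: (mix) => //; apply: sC;
  [by left; left; left|by left; left; right|by right|by left; right].
Qed.

Definition gram p q : R := dotp p p * dotp q q - dotp p q ^+ 2.

(** |p|^2 gram p q is the squared norm of the vector |p|^2 q - (p.q) p, which
    is nonzero when p and q are independent. *)
Lemma gram_gt0 p q :
  (forall x y : R, x *: p + y *: q = 0 -> x = 0 /\ y = 0) -> 0 < gram p q.
Proof.
move=> pq.
have p0 : p != 0.
  apply/eqP => p0; case: (pq 1 0); first by rewrite p0 scaler0 scale0r addr0.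
  by move/eqP; rewrite oner_eq0.
have pp := dotp_gt0 p0.
have w0 : - dotp p q *: p + dotp p p *: q != 0.
  by apply/eqP => /pq [_ e]; rewrite e ltxx in pp.
have := dotp_gt0 w0.
have -> : dotp (- dotp p q *: p + dotp p p *: q)
               (- dotp p q *: p + dotp p p *: q) = dotp p p * gram p q.
  by rewrite !dotpE (dotpC q p) /gram; ring.
by rewrite pmulr_rgt0.
Qed.

End Space.

(** * Planar area *)

Section Area.
Context {R : realType}.
Implicit Types (A p q u v o : 'rV[R]_3).

(** Lagrange's identity in the coordinates of an orthonormal pair. *)
Lemma gram_orthonormal u v (a b c d : R) : orthonormal_pair u v ->
  gram (a *: u + b *: v) (c *: u + d *: v) = (a * d - b * c) ^+ 2.
Proof. by move=> [uu vv uv]; rewrite /gram !dotpE (dotpC v u) uu vv uv; ring. Qed.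

Lemma plane_point_inj o u v : orthonormal_pair u v -> injective (plane_point o u v).
Proof.
move=> [uu vv uv] [x y] [x' y']; rewrite /plane_point /= -!addrA => /addrI e.
have := congr1 (dotp ^~ u) e; have := congr1 (dotp ^~ v) e.
by rewrite /= !dotpE (dotpC v u) uu vv uv !mulr1 !mulr0 !addr0 !add0r => -> ->.
Qed.

(** Gram-Schmidt orthonormalization, which provides Cartesian coordinates on the
    plane of a parallelogram. *)
Lemma plane_span p q : 0 < gram p q -> exists u v (a b c : R),
  [/\ orthonormal_pair u v, p = a *: u & q = b *: u + c *: v].
Proof.
move=> g0.
have p0 : 0 < dotp p p.
  rewrite lt_neqAle dotp_ge0 andbT eq_sym; apply: contraTneq g0 => pp.
  by rewrite /gram pp mul0r sub0r -leNgt oppr_le0 sqr_ge0.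
pose a := Num.sqrt (dotp p p); have a0 : a != 0 by rewrite gt_eqF// sqrtr_gt0.
have a2 : dotp p p = a ^+ 2 by rewrite sqr_sqrtr// dotp_ge0.
(* w is the component of q orthogonal to p. *)
pose w := q - (dotp p q / a ^+ 2) *: p.
have wwE : dotp w w = gram p q / a ^+ 2.
  by rewrite /w !dotpE (dotpC q p) /gram a2; field.
have pw : dotp p w = 0 by rewrite /w !dotpE a2; field.
have qw : q = (dotp p q / a ^+ 2) *: p + w by rewrite addrC subrK.
move: w wwE pw qw => w wwE pw qw.
have ww : 0 < dotp w w by rewrite wwE divr_gt0// -a2.
pose c := Num.sqrt (dotp w w); have c0 : c != 0 by rewrite gt_eqF// sqrtr_gt0.
have c2 : dotp w w = c ^+ 2 by rewrite sqr_sqrtr// dotp_ge0.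
exists (a^-1 *: p), (c^-1 *: w), a, (dotp p q / a), c; split.
- split; rewrite !dotpE ?a2 ?c2 ?pw ?mulr0//; field; [exact: a0|exact: c0].
- by rewrite scalerA divff// scale1r.
- rewrite [LHS]qw !scalerA divff// scale1r; congr (_ *: _ + _).
  by field.
Qed.

(** Any coordinates whose plane contains the parallelogram contain its vertices
    A, A + p and A + q, so they also express p and q in terms of u and v; thus
    the parallelogram reads as one of R^2 in these coordinates. *)
Theorem planar_area_parallelogram A p q : 0 < gram p q ->
  has_planar_area (parallelogram A p q) (Num.sqrt (gram p q)).
Proof.
move=> g0; split.
  have [u [v [a [b [c [uv pE qE]]]]]] := plane_span g0.
  exists A, u, v; split => // _ [s [t [_ _ ->]]].
  exists (s * a + t * b, t * c) => //.
  by rewrite /plane_point/= pE qE; apply/rowP => i; rewrite !mxE; ring.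
move=> o u v uv S.
have i0 : (0 : R) \in `[0, 1] by rewrite in_itv/= lexx ler01.
have i1 : (1 : R) \in `[0, 1] by rewrite in_itv/= lexx ler01.
have [[a1 a2] _ aE] : range (plane_point o u v) A.
  by apply: S; exists 0, 0; rewrite !scale0r !addr0.
have [[b1 b2] _ bE] : range (plane_point o u v) (A + p).
  by apply: S; exists 1, 0; rewrite scale0r scale1r addr0.
have [[c1 c2] _ cE] : range (plane_point o u v) (A + q).
  by apply: S; exists 0, 1; rewrite scale0r scale1r addr0.
have pE : p = (b1 - a1) *: u + (b2 - a2) *: v.
  rewrite -[LHS](addKr A) -bE -aE /plane_point/=.
  by apply/rowP => i; rewrite !mxE; ring.
have qE : q = (c1 - a1) *: u + (c2 - a2) *: v.
  rewrite -[LHS](addKr A) -cE -aE /plane_point/=.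
  by apply/rowP => i; rewrite !mxE; ring.
have pre : plane_point o u v @^-1` parallelogram A p q =
    parallelogram2 a1 a2 (b1 - a1) (b2 - a2) (c1 - a1) (c2 - a2).
  have E s t : A + s *: p + t *: q = plane_point o u v
      (a1 + s * (b1 - a1) + t * (c1 - a1), a2 + s * (b2 - a2) + t * (c2 - a2)).
    rewrite -aE pE qE /plane_point/=.
    by apply/rowP => i; rewrite !mxE; ring.
  apply/seteqP; split => -[x y] [s [t [s01 t01]]].
    by rewrite E => /(plane_point_inj uv)[-> ->]; exists s, t.
  by move=> /= -> ->; exists s, t; split => //; rewrite E.
move: g0; rewrite pE qE gram_orthonormal// -pE -qE pre => g0.
rewrite lebesgue2_parallelogram2 ?sqrtr_sqr//.
by apply: contraTneq g0 => ->; rewrite expr0n ltxx.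
Qed.

End Area.

Theorem theorem2 (R : realType) (P1 P2 P3 P4 : 'rV[R]_3) (a b c d e f : R)
  (hT : tetrahedron P1 P2 P3 P4)
  (ha : a = edist P1 P2) (hb : b = edist P1 P3) (hc : c = edist P3 P4)
  (hd : d = edist P2 P3) (he : e = edist P1 P4) (hf : f = edist P2 P4) :
  has_planar_area (medial_parallelogram P2 P3 P1 P4)
    (8^-1 * Num.sqrt (4 * d ^+ 2 * e ^+ 2
                      - (b ^+ 2 + f ^+ 2 - a ^+ 2 - c ^+ 2) ^+ 2)).
Proof.
pose p := 2^-1 *: (P3 - P2); pose q := 2^-1 *: (P4 - P1).
have -> : medial_parallelogram P2 P3 P1 P4 = parallelogram (midpoint P2 P1) p q.
  rewrite -convex_hull_parallelogram /medial_parallelogram.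
  congr (convex_hull [set _; _; _; _]); apply/rowP => i;
    by rewrite /p /q /midpoint !mxE; field.
have g0 : 0 < gram p q.
  apply: gram_gt0 => x y xy.
  (* A relation between P3 - P2 and P4 - P1, written in terms of the three
     independent edges at P1, has coefficients - x, x and y. *)
  have /freeP /(_ (fun i => [:: - x; x; y]`_i)) := hT.
  rewrite !big_ord_recl big_ord0 /= => h.
  have {}h : forall i : 'I_3, [:: - x; x; y]`_i = 0.
    apply: h; transitivity (2 *: (x *: p + y *: q)); last by rewrite xy scaler0.
    by apply/rowP => i; rewrite !mxE; field.
  split; first exact: (h (Ordinal (erefl : 1 < 3)%N)).
  exact: (h (Ordinal (erefl : 2 < 3)%N)).
have -> : 4 * d ^+ 2 * e ^+ 2 - (b ^+ 2 + f ^+ 2 - a ^+ 2 - c ^+ 2) ^+ 2 =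
    8 ^+ 2 * gram p q.
  rewrite ha hb hc hd he hf !sqr_edist /gram /p /q !dotpE.
  rewrite (dotpC P2 P1) (dotpC P3 P1) (dotpC P4 P1).
  rewrite (dotpC P3 P2) (dotpC P4 P2) (dotpC P4 P3).
  by field.
rewrite sqrtrM ?sqr_ge0// sqrtr_sqr ger0_norm// mulKf//.
exact: planar_area_parallelogram.
Qed.
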